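(* Let $\omega_s,\omega_a\in(0,2]$ satisfy $\omega_s\mathcal{L}_1\ge\max(0,\omega_s-1)$ and, for every $\ell\in\{1,\dots,W\}$, $$\omega_a\max_{u\in[-u_\infty,u_\infty]}\Bigl|\sum_{k=1}^d\mathcal{N}_{2\ell,k}\varphi_k'(u)\Bigr|\le\omega_s\mathcal{L}_{2\ell}+\tfrac12\min\bigl(2-\omega_s-\omega_a,\ 0,\ \omega_a-\omega_s\bigr).$$ Then, for all $n\in\mathbb{N}$ and all $j\in\mathbb{Z}^d$, $$(f_{1,j}^n,\dots,f_{q,j}^n)\in K\qquad\text{and}\qquad u_j^n=\sum_{i=1}^q f_{i,j}^n\in[-u_\infty,u_\infty].$$ Therefore $\|u_\Delta\|_{L^\infty}\le u_\infty$ and $\|f_\Delta\|_{L^\infty}\le\sum_{i=1}^q\max\bigl(|f_i^{\rm eq}(-u_\infty)|,|f_i^{\rm eq}(u_\infty)|\bigr)$.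
   Context: Setting. Let $d,W\ge 1$ be integers, $q=1+2W$, $\lambda>0$. Discrete velocities: $c_1=0$ and $c_{2\ell}=-c_{2\ell+1}\in\lambda\mathbb{Z}^d$ for $\ell=1,\dots,W$; $c_{i,k}$ is the $k$-th component of $c_i$. Fluxes $\varphi_k\in C^1(\mathbb{R})$, $k=1,\dots,d$, are non-constant with $\varphi_k(0)=0$. The initial datum is $u^\circ\in L^1(\mathbb{R}^d)\cap L^\infty(\mathbb{R}^d)\cap BV(\mathbb{R}^d)$ and $u_\infty:=\|u^\circ\|_{L^\infty}$. Equilibria: $f_i^{\rm eq}(u)=\mathcal{L}_i u+\sum_{k=1}^d\mathcal{N}_{i,k}\varphi_k(u)$, $i=1,\dots,q$, with real coefficients satisfying $\mathcal{L}_{2\ell}=\mathcal{L}_{2\ell+1}$, $\mathcal{N}_{2\ell,k}=-\mathcal{N}_{2\ell+1,k}\ge 0$, $\mathcal{L}_1+2\sum_{\ell=1}^W\mathcal{L}_{2\ell}=1$, $\mathcal{N}_{1,k}=0$, and $2\sum_{\ell=1}^W c_{2\ell,k}\mathcal{N}_{2\ell,p}=\delta_{k,p}$ for all $k,p\in\{1,\dots,d\}$. Compact set: $K:=\prod_{i=1}^q[f_i^{\rm eq}(-u_\infty),f_i^{\rm eq}(u_\infty)]$. Relaxation operator $\mathcal{R}=(\mathcal{R}_1,\dots,\mathcal{R}_q):\mathbb{R}^q\to\mathbb{R}^q$: for $f\in\mathbb{R}^q$ set $u=\sum_{i=1}^q f_i$ and $\mathcal{R}_1(f)=(1-\omega_s)f_1+\omega_s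 f_1^{\rm eq}(u)$, $\mathcal{R}_{2\ell}(f)=\bigl(1-\tfrac12(\omega_s+\omega_a)\bigr)f_{2\ell}+\tfrac12(\omega_s+\omega_a)f_{2\ell}^{\rm eq}(u)-\tfrac12(\omega_s-\omega_a)\bigl(f_{2\ell+1}-f_{2\ell+1}^{\rm eq}(u)\bigr)$, $\mathcal{R}_{2\ell+1}(f)=\bigl(1-\tfrac12(\omega_s+\omega_a)\bigr)f_{2\ell+1}+\tfrac12(\omega_s+\omega_a)f_{2\ell+1}^{\rm eq}(u)-\tfrac12(\omega_s-\omega_a)\bigl(f_{2\ell}-f_{2\ell}^{\rm eq}(u)\bigr)$. Scheme. Let $\Delta x>0$, $\Delta t=\Delta x/\lambda$, $t^n=n\Delta t$, and for $j\in\mathbb{Z}^d$ let $C_j=\prod_{k=1}^d\bigl((j_k-\tfrac12)\Delta x,(j_k+\tfrac12)\Delta x\bigr)$. Initialization: $f_{i,j}^0=f_i^{\rm eq}\bigl(\frac{1}{|C_j|}\int_{C_j}u^\circ(x)\,\mathrm{d}x\bigr)$. Evolution: $f_{i,j}^{n+1}=\mathcal{R}_i\bigl(f_{1,j-c_i/\lambda}^n,\dots,f_{q,j-c_i/\lambda}^n\bigr)$ for $n\in\mathbb{N}$, $j\in\mathbb{Z}^d$, $i\in\{1,\dots,q\}$. Set $u_j^n=\sum_{i=1}^q f_{i,j}^n$. Piecewise constant reconstructions (defined a.e.): $f_\Delta(t,x)=(f_{1,j}^n,\dots,f_{q,j}^n)$ and $u_\Delta(t,x)=u_j^n$ for $t\in[t^n,t^{n+1})$,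 $x\in C_j$. The space $\mathbb{R}^q$ is endowed with the $\ell^1$-norm, which is used in defining norms of $\mathbb{R}^q$-valued functions. *)

(* Defs.v *)
From HB Require Import structures.
From mathcomp Require Import all_boot all_order all_algebra.
From mathcomp Require Import all_classical all_reals all_analysis.
From mathcomp Require Import lra.

Set Implicit Arguments.
Unset Strict Implicit.
Unset Printing Implicit Defensive.

Import Order.TTheory GRing.Theory Num.Theory.
Import numFieldNormedType.Exports.

Local Open Scope classical_set_scope.
Local Open Scope ring_scope.

(* The sigma-algebra on R^n generated by the coordinates, i.e. the Borel
   sigma-algebra; this is how the library equips [n.-tuple T]. *)
Section measurable_rV.
Context {d : measure_display} {T : measurableType d} (n : nat).

Definition rV_coord : 'I_n -> 'rV[T]_n -> T := fun i x => x 0 i.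

Let rV_set0 : g_sigma_preimage rV_coord set0.
Proof. exact: sigma_algebra0. Qed.

Let rV_setC A : g_sigma_preimage rV_coord A -> g_sigma_preimage rV_coord (~` A).
Proof. exact: sigma_algebraC. Qed.

Let rV_bigcup (F : _^nat) : (forall i, g_sigma_preimage rV_coord (F i)) ->
  g_sigma_preimage rV_coord (\bigcup_i (F i)).
Proof. exact: sigma_algebra_bigcup. Qed.

HB.instance Definition _ := @isMeasurable.Build (measure_tuple_display d)
  'rV[T]_n (g_sigma_preimage rV_coord) rV_set0 rV_setC rV_bigcup.

End measurable_rV.

Section measurable_rV_theory.
Context {d d1 : measure_display} {T : measurableType d} {T1 : measurableType d1}.

Lemma measurable_rV_coord n (i : 'I_n) :
  measurable_fun [set: 'rV[T]_n] (fun x : 'rV[T]_n => x 0 i).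
Proof.
move=> _ Y mY; rewrite setTI; apply: sub_sigma_algebra => /=.
rewrite -bigcup_seq/=; exists i => /=; first by rewrite mem_index_enum.
by exists Y => //; rewrite setTI.
Qed.

Lemma measurable_fun_rV n (f : T1 -> 'rV[T]_n) :
  (forall i, measurable_fun [set: T1] (fun x => f x 0 i)) ->
  measurable_fun [set: T1] f.
Proof.
move=> mf.
suff: g_sigma_preimage (fun i => @rV_coord _ T n i \o f) `<=` measurable.
  by rewrite g_sigma_preimage_comp => prefS _ A mA; apply: prefS; exists A.
apply: smallest_sub; first exact: sigma_algebra_measurable.
case: n => [|n] in f mf *; first by rewrite big_ord0.
rewrite -bigcup_mkord_ord; apply: bigcup_sub => i Ii.
by move=> A [B mB <-]; exact: mf.
Qed.

End measurable_rV_theory.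

Section rV_cons.
Context {R : realType}.

Definition rV_cons n (p : R * 'rV[R]_n) : 'rV[R]_n.+1 :=
  \row_(k < n.+1) oapp (p.2 0) p.1 (unlift ord0 k).

Definition rV_uncons n (x : 'rV[R]_n.+1) : R * 'rV[R]_n :=
  (x 0 ord0, \row_(k < n) x 0 (lift ord0 k)).

Lemma rV_consK n : cancel (@rV_cons n) (@rV_uncons n).
Proof.
case=> x y; rewrite /rV_uncons mxE unlift_none/=; congr (_, _).
by apply/rowP => k; rewrite !mxE liftK.
Qed.

Lemma measurable_rV_cons n : measurable_fun setT (@rV_cons n).
Proof.
apply: measurable_fun_rV => i; rewrite /rV_cons.
under eq_fun do rewrite mxE.
case: unliftP => [j _|_] /=; last exact: measurable_fst.
exact: (measurableT_comp (measurable_rV_coord j) measurable_snd).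
Qed.

Lemma measurable_rV_uncons n : measurable_fun setT (@rV_uncons n).
Proof.
apply: measurable_fun_pair => /=; first exact: (measurable_rV_coord ord0).
apply: measurable_fun_rV => i; under eq_fun do rewrite mxE.
exact: (measurable_rV_coord (lift ord0 i)).
Qed.

End rV_cons.

Section lebesgue_step.
Local Open Scope ereal_scope.
Context {R : realType} (n : nat)
  (m : {sigma_finite_measure set 'rV[R]_n -> \bar R}).

Definition lebesgue_step : set 'rV[R]_n.+1 -> \bar R :=
  pushforward (@lebesgue_measure R \x m) (@rV_cons R n).

Let mu : {measure set 'rV[R]_n.+1 -> \bar R} :=
  measure_function_pushforward__canonical__measure_function_Measure
    (@lebesgue_measure R \x m) (@measurable_rV_cons R n).

HB.instance Definition _ := isMeasure.Build _ _ _ lebesgue_step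
  (measure0 mu) (measure_ge0 mu) (@measure_semi_sigma_additive _ _ _ mu).

Let lebesgue_step_sigma_finite : sigma_finite setT lebesgue_step.
Proof.
have /sigma_finiteP[F [TF ndF Foo]] := sigma_finiteT (@lebesgue_measure R).
have /sigma_finiteP[G [TG ndG Goo]] := sigma_finiteT m.
exists (fun k => @rV_uncons R n @^-1` (F k `*` G k)) => [|k].
  apply/esym/seteqP; split => // z _.
  have [a _ Fa] : (\bigcup_i F i) (rV_uncons z).1 by rewrite -TF.
  have [b _ Gb] : (\bigcup_i G i) (rV_uncons z).2 by rewrite -TG.
  exists (maxn a b) => //; split.
  - by move: Fa; exact/subsetPset/ndF/leq_maxl.
  - by move: Gb; exact/subsetPset/ndG/leq_maxr.
have [mF Fk] := Foo k; have [mG Gk] := Goo k; split.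
  rewrite -[X in measurable X]setTI; apply: measurable_rV_uncons => //.
  exact: measurableX.
rewrite /lebesgue_step /pushforward -comp_preimage.
have -> : @rV_uncons R n \o @rV_cons R n = id.
  by apply/funext => x /=; rewrite rV_consK.
rewrite preimage_id [ltLHS]product_measure1E//.
by rewrite lte_mul_pinfty// ge0_fin_numE.
Qed.

HB.instance Definition _ := Measure_isSigmaFinite.Build _ _ _ lebesgue_step
  lebesgue_step_sigma_finite.

End lebesgue_step.

Section lebesgue_rV.
Context {R : realType}.

Fixpoint lebesgue_rV n : {sigma_finite_measure set 'rV[R]_n -> \bar R} :=
  if n is n'.+1 then lebesgue_step (lebesgue_rV n') else dirac (0 : 'rV[R]_0).

Lemma measurable_rV_box n (A : 'I_n -> set R) :
  (forall k, measurable (A k)) ->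
  measurable [set x : 'rV[R]_n | forall k, A k (x 0 k)].
Proof.
move=> mA.
rewrite (_ : [set _ | _] =
    \bigcap_(k in [set: 'I_n]) ((fun x : 'rV[R]_n => x 0 k) @^-1` A k)).
  apply: fin_bigcap_measurable => // k _.
  by rewrite -[X in measurable X]setTI; exact: (measurable_rV_coord k).
by apply/seteqP; split => [x Ax k _|x Ax k] /=; [exact: Ax|exact: (Ax k)].
Qed.

Lemma lebesgue_rV_box n (A : 'I_n -> set R) :
  (forall k, measurable (A k)) ->
  lebesgue_rV n [set x | forall k, A k (x 0 k)] =
  (\prod_(k < n) @lebesgue_measure R (A k))%E.
Proof.
elim: n A => [|n IHn] A mA.
  rewrite big_ord0 /= /dirac indicE mem_set//= => -[].
  by case.
rewrite big_ord_recl -IHn//.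
pose B := A ord0 `*` [set y : 'rV[R]_n | forall k, A (lift ord0 k) (y 0 k)].
have EB : @rV_cons R n @^-1` [set x | forall k, A k (x 0 k)] = B.
  apply/seteqP; split => -[x y] /=.
  - move=> Axy; split => [|k]; first by have := Axy ord0; rewrite mxE unlift_none.
    by have := Axy (lift ord0 k); rewrite mxE liftK.
  - by move=> [Ax Ay] k; rewrite mxE; case: unliftP => [j ->|->] //=.
transitivity ((@lebesgue_measure R \x lebesgue_rV n)%E B); first by rewrite -EB.
rewrite [LHS]product_measure1E//; first exact: mA.
exact: (measurable_rV_box (fun k => mA (lift ord0 k))).
Qed.

End lebesgue_rV.

Section BV.
Context {R : realType} (d : nat).

(* Admissible fields in the definition of the total variation:
   C^1, compactly supported, of pointwise Euclidean norm at most 1. *)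
Definition test_field (phi : 'rV[R]_d -> 'rV[R]_d) : Prop :=
  [/\ forall x, differentiable phi x,
      forall v, continuous (fun x => 'D_v phi x),
      compact (closure [set x | phi x != 0]) &
      forall x, \sum_(k < d) phi x 0 k ^+ 2 <= 1].

Definition divergence (phi : 'rV[R]_d -> 'rV[R]_d) (x : 'rV[R]_d) : R :=
  \sum_(k < d) ('D_(delta_mx 0 k) phi x) 0 k.

Definition total_variation (u : 'rV[R]_d -> R) : \bar R :=
  ereal_sup [set (\int[lebesgue_rV d]_x (u x * divergence phi x)%:E)%E
            | phi in test_field].

Definition BV (u : 'rV[R]_d -> R) : Prop :=
  u \in Lfun (lebesgue_rV d) 1%E /\ (total_variation u < +oo)%E.

End BV.

(* Indices of the q = 1 + 2W discrete velocities: [None] is the index 1 of the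
   zero velocity, and for l : 'I_W (so that l + 1 ranges over 1..W)
   [vplus l] is the index 2(l+1) and [vminus l] the index 2(l+1)+1. *)
Notation vindex W := (option ('I_W * bool)).

Definition vzero {W : nat} : vindex W := None.
Definition vplus {W : nat} (l : 'I_W) : vindex W := Some (l, false).
Definition vminus {W : nat} (l : 'I_W) : vindex W := Some (l, true).

Lemma card_vindex (W : nat) : #|{: vindex W}| = (1 + 2 * W)%N.
Proof. by rewrite card_option card_prod card_ord card_bool mulnC. Qed.

Section scheme.
Context {R : realType} {d W : nat}.

(* The velocity c_i in lambda Z^d is given by the lattice vector
   e_i = c_i / lambda in Z^d. *)
Definition velocity (lam : R) (e : vindex W -> 'rV[int]_d) (i : vindex W) :
    'rV[R]_d := lam *: map_mx intr (e i).

Definition equilibrium (L : vindex W -> R) (N : vindex W -> 'I_d -> R)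
    (phi : 'I_d -> R -> R) (i : vindex W) (u : R) : R :=
  L i * u + \sum_(k < d) N i k * phi k u.

Definition moment (f : vindex W -> R) : R := \sum_i f i.

Definition l1norm (f : vindex W -> R) : R := \sum_i `|f i|.

Definition invariant_box (feq : vindex W -> R -> R) (uinf : R) :
    set (vindex W -> R) :=
  [set f | forall i, feq i (- uinf) <= f i <= feq i uinf].

Definition relaxation (omega_s omega_a : R) (feq : vindex W -> R -> R)
    (f : vindex W -> R) (i : vindex W) : R :=
  let u := moment f in
  match i with
  | None => (1 - omega_s) * f vzero + omega_s * feq vzero u
  | Some (l, false) =>
      (1 - 2^-1 * (omega_s + omega_a)) * f (vplus l)
      + 2^-1 * (omega_s + omega_a) * feq (vplus l) u
      - 2^-1 * (omega_s - omega_a) * (f (vminus l) - feq (vminus l) u)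
  | Some (l, true) =>
      (1 - 2^-1 * (omega_s + omega_a)) * f (vminus l)
      + 2^-1 * (omega_s + omega_a) * feq (vminus l) u
      - 2^-1 * (omega_s - omega_a) * (f (vplus l) - feq (vplus l) u)
  end.

Definition cell (dx : R) (j : 'rV[int]_d) : set 'rV[R]_d :=
  [set x | forall k, ((j 0 k)%:~R - 2^-1) * dx < x 0 k <
                     ((j 0 k)%:~R + 2^-1) * dx].

Definition cell_average (u0 : 'rV[R]_d -> R) (dx : R) (j : 'rV[int]_d) : R :=
  (fine (lebesgue_rV d (cell dx j)))^-1 *
  \int[lebesgue_rV d]_(x in cell dx j) u0 x.

(* [populations _ _ _ _ _ n j i] is f_{i,j}^n. *)
Fixpoint populations (e : vindex W -> 'rV[int]_d) (omega_s omega_a : R)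
    (feq : vindex W -> R -> R) (u0 : 'rV[R]_d -> R) (dx : R)
    (n : nat) (j : 'rV[int]_d) (i : vindex W) : R :=
  match n with
  | 0 => feq i (cell_average u0 dx j)
  | n'.+1 =>
      relaxation omega_s omega_a feq
        (populations e omega_s omega_a feq u0 dx n' (j - e i)) i
  end.

End scheme.

Section reconstruction.
Context {R : realType} {d : nat}.

(* [g] is a piecewise constant reconstruction on [0, +oo[ x R^d of the discrete
   values [v n j]: as it is only defined almost everywhere, its values on the
   boundaries of the cells are left unspecified. *)
Definition is_reconstruction {V : Type} (dt dx : R)
    (v : nat -> 'rV[int]_d -> V) (g : R * 'rV[R]_d -> V) : Prop :=
  forall n j t x, n%:R * dt <= t < n.+1%:R * dt -> cell dx j x ->
    g (t, x) = v n j.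

Lemma is_reconstruction_exists {V : Type} (dt dx : R)
    (v : nat -> 'rV[int]_d -> V) : 0 < dt -> 0 < dx ->
  exists g, is_reconstruction dt dx v g.
Proof.
move=> dt0 dx0.
exists (fun p : R * 'rV[R]_d => v `|Num.floor (p.1 / dt)|%N
  (\row_k Num.floor (p.2 0 k / dx + 2^-1))) => n j t x /= /andP[nt tn] jx.
have -> : Num.floor (t / dt) = n.
  apply: floor_def; rewrite ler_pdivlMr// ltr_pdivrMr// intrD.
  by move: nt tn; rewrite -natr1 => -> ->.
congr (v _ _); apply/rowP => k; rewrite mxE; apply: floor_def.
have /andP[jx1 jx2] := jx k.
rewrite -lerBlDr ler_pdivlMr// (ltW jx1)/= -ltrBrDr ltr_pdivrMr//.
by apply: (lt_le_trans jx2); rewrite ler_pM2r// intrD; lra.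
Qed.

Definition spacetime : set (measurableTypeR R * 'rV[R]_d) := `[0, +oo[ `*` setT.

Lemma measurable_spacetime : measurable spacetime.
Proof. exact: measurableX. Qed.

Definition spacetime_measure :
    {measure set (measurableTypeR R * 'rV[R]_d) -> \bar R} :=
  mrestr (@lebesgue_measure R \x lebesgue_rV d)%E measurable_spacetime.

End reconstruction.

(* Main.v *)
(* Under the stated conditions the relaxation operator is nondecreasing in each
   argument on K: its derivative is omega_s L_i +- omega_a (sum_k N_ik phi_k)'
   plus, in the directions i and its opposite, 1 - (omega_s + omega_a)/2 and
   (omega_a - omega_s)/2. It fixes the two extreme corners f^eq(-uinf) and
   f^eq(uinf) of K, hence maps K into itself; the initial data lie in K because
   each equilibrium is nondecreasing on [-uinf, uinf]. The moments of elements of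
   K lie in [-uinf, uinf] since the equilibria sum to the identity. *)
Require Import Defs.
From HB Require Import structures.
From mathcomp Require Import all_boot all_order all_algebra.
From mathcomp Require Import all_classical all_reals all_analysis.
From mathcomp Require Import ess_sup_inf lra ring.

Set Implicit Arguments.
Unset Strict Implicit.
Unset Printing Implicit Defensive.

Import Order.TTheory GRing.Theory Num.Theory.
Import numFieldNormedType.Exports.

Local Open Scope classical_set_scope.
Local Open Scope ring_scope.

Lemma big_vindex (V : nmodType) (W : nat) (F : vindex W -> V) :
  \sum_i F i = F vzero + \sum_(l < W) (F (vplus l) + F (vminus l)).
Proof.
rewrite (bigD1 vzero)//=; congr (_ + _).
rewrite (reindex_omap Some id) => [|[i|]//] /=.
under eq_bigl do rewrite eqxx.
under [RHS]eq_bigr do rewrite addrC -(big_bool _ (fun b => F (Some (_, b)))).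
by rewrite pair_bigA; apply: eq_bigr => -[].
Qed.

(** * Order properties of the equilibria and of the relaxation operator *)

Section relaxation_monotone.
Variables (R : realType) (d W : nat) (phi : 'I_d -> R -> R).
Variables (L : vindex W -> R) (N : vindex W -> 'I_d -> R).
Hypothesis L_sym : forall l, L (vplus l) = L (vminus l).
Hypothesis N_odd : forall l k, N (vplus l) k = - N (vminus l) k.
Hypothesis L_sum1 : L vzero + 2 * (\sum_(l < W) L (vplus l)) = 1.
Hypothesis N_vzero : forall k, N vzero k = 0.

Let feq := equilibrium L N phi.
Let S l v := \sum_(k < d) N (vplus l) k * phi k v.

Lemma equilibrium_vzero u : feq vzero u = L vzero * u.
Proof.
rewrite /feq /equilibrium big1 ?addr0// => k _.
by rewrite N_vzero mul0r.
Qed.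

Lemma equilibrium_vminus l u : feq (vminus l) u = L (vplus l) * u - S l u.
Proof.
rewrite /feq /equilibrium -L_sym -sumrN; congr (_ + _).
by apply: eq_bigr => k _; rewrite N_odd mulNr opprK.
Qed.

Lemma moment_equilibrium u : moment (feq ^~ u) = u.
Proof.
rewrite /moment big_vindex equilibrium_vzero.
under eq_bigr => l _.
  rewrite equilibrium_vminus {1}/feq/equilibrium.
  rewrite addrACA subrr addr0 -mulrDl -mulr2n -mulr_natl; over.
by rewrite -mulr_suml -mulr_sumr -mulrDl L_sum1 mul1r.
Qed.

Variables (omega_s omega_a : R).

Lemma relaxation_equilibrium u :
  relaxation omega_s omega_a feq (feq ^~ u) = feq ^~ u.
Proof.
apply/funext => -[[l []]|]; rewrite /relaxation moment_equilibrium;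
  by rewrite ?subrr; ring.
Qed.

(** The flux derivatives enter only through a Lipschitz constant [M l] of the nonlinear part [S l],
    so the order properties reduce to linear arithmetic on increments. *)
Variables (U : R) (M : 'I_W -> R).
Hypothesis M_ge0 : forall l, 0 <= M l.
Hypothesis S_lip : forall l x y, - U <= x -> x <= y -> y <= U ->
  `|S l y - S l x| <= M l * (y - x).
Hypothesis omega_s_gt0 : 0 < omega_s.
Hypothesis omega_a_gt0 : 0 < omega_a.
Hypothesis cond_vzero : Num.max 0 (omega_s - 1) <= omega_s * L vzero.
Hypothesis cond_vplus : forall l, omega_a * M l <= omega_s * L (vplus l) +
  2^-1 * Num.min (2 - omega_s - omega_a) (Num.min 0 (omega_a - omega_s)).

Let L_vzero_ge0 : 0 <= L vzero.
Proof.
by move: cond_vzero; rewrite ge_max pmulr_rge0// => /andP[].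
Qed.

(** Minus half the minimum is the witness [m]; its bounds replace the minimum by linear
    inequalities. *)
Let cond l : exists m, [/\ 0 <= m, omega_s + omega_a - 2 <= 2 * m,
  omega_s - omega_a <= 2 * m &
  omega_a * M l + m <= omega_s * L (vplus l)].
Proof.
set m := Num.min (2 - omega_s - omega_a) (Num.min 0 (omega_a - omega_s)).
exists (- (2^-1 * m)).
have := cond_vplus l; rewrite -/m => h.
have : m <= m by [].
rewrite {2}/m !le_min => /and3P[h1 h2 h3]; split; lra.
Qed.

Let L_vplus_ge0 l : 0 <= L (vplus l).
Proof.
have [m [m0 _ _ h]] := cond l.
have aM := mulr_ge0 (ltW omega_a_gt0) (M_ge0 l).
by rewrite -(pmulr_rge0 _ omega_s_gt0); lra.
Qed.

(* If [omega_s <= omega_a] this is immediate. Otherwise [cond_vplus] gives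
   [M l <= L l + (omega_s - omega_a) / omega_a * (L l - 1/2)], and [L l <= 1/2]
   because the coefficients are nonnegative and sum to 1. *)
Lemma lip_le_L l : M l <= L (vplus l).
Proof.
have [m [m0 h1 h2 h3]] := cond l.
have Lh : L (vplus l) <= 2^-1.
  have := L_sum1; rewrite (bigD1 l)//=.
  have : 0 <= \sum_(i < W | i != l) L (vplus i) by exact: sumr_ge0.
  have := L_vzero_ge0; lra.
rewrite -(ler_pM2l omega_a_gt0).
have [sa|/ltW sa] := leP omega_s omega_a.
  have : omega_s * L (vplus l) <= omega_a * L (vplus l) by exact: ler_wpM2r.
  lra.
have : 0 <= (omega_s - omega_a) * (2^-1 - L (vplus l)).
  by rewrite mulr_ge0// subr_ge0.
lra.
Qed.

(** The slope [L] of the linear part dominates the Lipschitz constant of [S] by [lip_le_L]; for the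
    zero velocity only the linear part, with nonnegative slope, is present. *)
Lemma equilibrium_homo i x y : - U <= x -> x <= y -> y <= U ->
  feq i x <= feq i y.
Proof.
move=> Ux xy yU.
have D0 : 0 <= y - x by rewrite subr_ge0.
case: i => [[l b]|]; last first.
  by rewrite !equilibrium_vzero ler_wpM2l.
have := S_lip l Ux xy yU; rewrite ler_norml => /andP[s1 s2].
have := ler_wpM2r D0 (lip_le_L l) => s3.
case: b; first by rewrite !equilibrium_vminus; lra.
rewrite /feq /equilibrium -/(S l x) -/(S l y); lra.
Qed.

Lemma relaxation_homo f g : (forall i, f i <= g i) ->
  - U <= moment f -> moment g <= U ->
  forall i, relaxation omega_s omega_a feq f i <=
            relaxation omega_s omega_a feq g i.
Proof.
move=> fg Uf gU i.
have h0 j : 0 <= g j - f j by rewrite subr_ge0.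
(* All increments are nonnegative, so the increment of the moment dominates any partial sum of
   them. *)
have Dge (A : {pred vindex W}) : \sum_(j in A) (g j - f j) <= moment g - moment f.
  rewrite /moment -sumrB [leRHS](bigID (mem A))/= lerDl.
  exact: sumr_ge0.
have fgm : moment f <= moment g by exact: ler_sum.
have Dpm l : g (vplus l) - f (vplus l) + (g (vminus l) - f (vminus l)) <=
    moment g - moment f.
  apply: le_trans (Dge (pred2 (vplus l) (vminus l))).
  rewrite (bigD1 (vplus l)) ?inE ?eqxx//= (big_pred1 (vminus l))//.
  move=> i'; rewrite !inE/=; case: (eqVneq i' (vplus l)) => [->|_] /=.
    by apply/esym/eqP => -[].
  by rewrite andbT.
have D0 : 0 <= moment g - moment f by rewrite subr_ge0.
case: i => [[l b]|]; last first.
  rewrite /relaxation !equilibrium_vzero.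
  have := Dge (pred1 vzero); rewrite big_pred1_eq => hD.
  move: cond_vzero; rewrite ge_max => /andP[c1 c2].
  have := ler_wpM2l c1 hD; have := ler_wpM2r (h0 vzero) c2; lra.
(* Write [D], [a], [b] for the increments of the moment, of the component treated and of its
   opposite. The relaxed component grows by [(1 - (omega_s + omega_a) / 2) * a - (omega_s - omega_a)
   / 2 * b + omega_s * L * D] plus or minus [omega_a] times the increment of [S]. By [h3] and the
   Lipschitz bound the last two terms are together at least [m * D], hence at least [m * (a + b)];
   then [h1] and [h2] make the coefficients of [a] and [b] nonnegative. *)
have [m [m0 h1 h2 h3]] := cond l.
have := S_lip l Uf fgm gU; rewrite ler_norml => /andP[s1 s2].
have := ler_wpM2l m0 (Dpm l); have := ler_wpM2r D0 h3.
have := ler_wpM2l (ltW omega_a_gt0) s1; have := ler_wpM2l (ltW omega_a_gt0) s2.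
have := ler_wpM2r (h0 (vplus l)) h1; have := ler_wpM2r (h0 (vplus l)) h2.
have := ler_wpM2r (h0 (vminus l)) h1; have := ler_wpM2r (h0 (vminus l)) h2.
by case: b; rewrite /relaxation !equilibrium_vminus /feq /equilibrium;
  rewrite -!/(S l _); lra.
Qed.

Lemma invariant_box_moment f : invariant_box feq U f -> - U <= moment f <= U.
Proof.
move=> Kf; rewrite -{1}(moment_equilibrium (- U)) -{2}(moment_equilibrium U).
by apply/andP; split; apply: ler_sum => i _; have /andP[] := Kf i.
Qed.

Lemma invariant_box_relaxation f : 0 <= U ->
  invariant_box feq U f -> invariant_box feq U (relaxation omega_s omega_a feq f).
Proof.
move=> U0 Kf i.
have /andP[mf1 mf2] := invariant_box_moment Kf.
have UU : - U <= U by lra.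
have fix_feq u : feq i u = relaxation omega_s omega_a feq (feq ^~ u) i.
  by rewrite relaxation_equilibrium.
rewrite (fix_feq (- U)) (fix_feq U).
by apply/andP; split; apply: relaxation_homo;
  rewrite ?moment_equilibrium// => j; have /andP[] := Kf j.
Qed.

Lemma invariant_box_equilibrium u : - U <= u <= U -> invariant_box feq U (feq ^~ u).
Proof.
by move=> /andP[Uu uU] i; rewrite !equilibrium_homo// (le_trans Uu).
Qed.

End relaxation_monotone.

(** * Lipschitz bounds for combinations of the fluxes *)

Section flux_lipschitz.
Variables (R : realType) (d : nat) (phi : 'I_d -> R -> R) (a : 'I_d -> R).
Hypothesis phi_C1 :
  forall k, (forall v, derivable (phi k) v 1) /\ continuous (derive1 (phi k)).

Lemma flux_is_derive v :
  is_derive (v : R) 1 (fun x => \sum_(k < d) a k * phi k x)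
    (\sum_(k < d) a k * derive1 (phi k) v).
Proof.
rewrite (_ : (fun x => _) = \sum_(k < d) (a k \*: phi k)); last first.
  by apply/funext => x; rewrite fct_sumE.
apply: is_derive_sum => k; rewrite derive1E.
apply: is_deriveZ; apply/derivableP; exact: (phi_C1 k).1.
Qed.

Variable U : R.
Let dS := [set `|\sum_(k < d) a k * derive1 (phi k) v| | v in `[- U, U]].

(** [sup] is an upper bound only for a set bounded above; a continuous function attains a maximum on
    the compact interval, which bounds [dS]. *)
Lemma flux_deriv_le v : - U <= v <= U ->
  `|\sum_(k < d) a k * derive1 (phi k) v| <= sup dS.
Proof.
move=> Uv.
have UU : - U <= U by lra.
have cS : continuous (fun v => `|\sum_(k < d) a k * derive1 (phi k) v|).
  move=> x; apply: cvg_norm; apply: cvg_big => [|k _].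
    exact: add_continuous.
  by apply: cvgMl_tmp; exact: (phi_C1 k).2.
have [c _ Hc] := EVT_max UU (continuous_subspaceT cS).
apply: ub_le_sup; last by exists v => //=; rewrite in_itv.
exists (`|\sum_(k < d) a k * derive1 (phi k) c|) => _ [w /= Uw <-].
exact: Hc.
Qed.

Lemma flux_deriv_sup_ge0 : 0 <= U -> 0 <= sup dS.
Proof.
move=> U_ge0.
apply: le_trans (flux_deriv_le (v := 0) _); first exact: normr_ge0.
by rewrite oppr_le0 U_ge0.
Qed.

(** The mean value theorem turns the supremum of the derivative into the Lipschitz constant required
    by [S_lip]. *)
Lemma flux_lipschitz x y : - U <= x -> x <= y -> y <= U ->
  `|\sum_(k < d) a k * phi k y - \sum_(k < d) a k * phi k x| <=
  sup dS * (y - x).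
Proof.
move=> Ux xy yU.
have cS : continuous (fun x => \sum_(k < d) a k * phi k x).
  move=> v; apply: differentiable_continuous.
  by apply/derivable1_diffP; case: (flux_is_derive v).
have [c /itvP cxy ->] := MVT_segment xy (fun v _ => flux_is_derive v)
  (continuous_subspaceT cS).
rewrite normrM (ger0_norm (_ : 0 <= y - x)) ?subr_ge0//.
rewrite ler_wpM2r ?subr_ge0// flux_deriv_le//.
by rewrite (le_trans Ux) ?cxy// (le_trans _ yU) ?cxy.
Qed.

End flux_lipschitz.

(** * Essential supremum norm and almost everywhere bounds *)

Section Lnormy.
Context d (T : measurableType d) (R : realType).
Variable mu : {measure set T -> \bar R}.
Local Open Scope ereal_scope.

Lemma ae_le_Lnormy (f : T -> \bar R) :
  \forall x \ae mu, `|f x| <= 'N[mu]_+oo[f].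
Proof.
rewrite unlock /=; case: ifPn => [_|mu0].
  exact: (ess_sup_ge mu (abse \o f)).
(* When the whole space is null the norm is 0 by convention, and the whole space serves as the
   exceptional set. *)
exists setT; split => //; apply/eqP.
by rewrite eq_le measure_ge0 andbT leNgt.
Qed.

Lemma Lnormy_le (f : T -> \bar R) (a : \bar R) : 0 <= a ->
  (\forall x \ae mu, `|f x| <= a) -> 'N[mu]_+oo[f] <= a.
Proof. by move=> a0 fa; rewrite unlock /=; case: ifPn => // _; exact/ess_supP. Qed.

End Lnormy.

(** * Cell averages and the null set left uncovered by the open cells *)

Section cells.
Variables (R : realType) (d : nat) (dx : R).
Hypothesis dx_gt0 : 0 < dx.

Let side (j : 'rV[int]_d) (k : 'I_d) : set R :=
  `](((j 0 k)%:~R - 2^-1) * dx), (((j 0 k)%:~R + 2^-1) * dx)[.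

Let cellE j : cell dx j = [set x | forall k, side j k (x 0 k)].
Proof.
by apply/seteqP; split=> x Cx k; have := Cx k; rewrite /side/= in_itv.
Qed.

Lemma measurable_cell (j : 'rV[int]_d) : measurable (cell dx j).
Proof.
rewrite cellE; apply: (measurable_rV_box (A := side j)) => k.
exact: measurable_itv.
Qed.

Lemma lebesgue_cell (j : 'rV[int]_d) :
  lebesgue_rV d (cell dx j) = (dx ^+ d)%:E.
Proof.
rewrite cellE (lebesgue_rV_box (A := side j)); last first.
  by move=> k; exact: measurable_itv.
rewrite (eq_bigr (fun=> dx%:E)); last first.
  move=> k _; rewrite lebesgue_measure_itv/= lte_fin ltr_pM2r// ltrD2l.
  by rewrite gt0_cp ?invr_gt0// -EFinB; congr (_%:E); field.
by rewrite prodEFin prodr_const card_ord.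
Qed.

Lemma cell_average_le (u0 : 'rV[R]_d -> R) (M : R) (j : 'rV[int]_d) :
  0 <= M -> u0 \in Lfun (lebesgue_rV d) 1%E ->
  (\forall x \ae lebesgue_rV d, `|u0 x| <= M) ->
  - M <= cell_average u0 dx j <= M.
Proof.
move=> M0 /Lfun1_integrable iu0 u0M.
rewrite -ler_norml /cell_average lebesgue_cell/=.
have dxd : 0 < dx ^+ d by exact: exprn_gt0.
rewrite normrM gtr0_norm ?invr_gt0// ler_pdivrMl// mulrC.
have iC : (lebesgue_rV d).-integrable (cell dx j) (EFin \o u0).
  by apply: integrableS iu0 => //; exact: measurable_cell.
have mC := measurable_cell j.
have finI : (\int[lebesgue_rV d]_(x in cell dx j) (u0 x)%:E)%E \is a fin_num.
  exact: integrable_fin_num.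
rewrite -lee_fin /Rintegral -abse_EFin fineK// EFinM -(lebesgue_cell j).
apply: le_trans (le_abse_integral _ mC (measurable_int _ iC)) _.
apply: integral_le_bound => //; first exact: measurable_int iC.
by apply: filterS u0M => x h _; rewrite lee_fin.
Qed.

(** Points in no open cell lie on countably many hyperplanes; each of these is a box with one side a
    point, hence null, since [0 * +oo = 0]. *)
Lemma ae_cell : \forall x \ae lebesgue_rV d, exists j, cell dx j x.
Proof.
pose H (k : 'I_d) (n : int) := [set x : 'rV[R]_d | x 0 k = (n%:~R - 2^-1) * dx].
have negH k n : (lebesgue_rV d).-negligible (H k n).
  pose A (i : 'I_d) : set R :=
    if i == k then [set (n%:~R - 2^-1) * dx] else setT.
  have mA i : measurable (A i) by rewrite /A; case: ifP.
  exists [set x : 'rV[R]_d | forall i, A i (x 0 i)]; split.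
  - exact: measurable_rV_box.
  - by rewrite lebesgue_rV_box// (bigD1 k)//= /A eqxx lebesgue_measure_set1 mul0e.
  - by move=> x Hx i; rewrite /A; case: eqP => // ->.
have : (lebesgue_rV d).-negligible (\bigcup_p H p.1 p.2).
  apply: (@negligibleS _ _ _ _ (\bigcup_n
      if unpickle n is Some p then H p.1 p.2 else set0)) => [x [p _ Hp]|].
    by exists (pickle p) => //; rewrite pickleK.
  apply: negligible_bigcup => n; case: unpickle => [p|]; first exact: negH.
  exact: negligible_set0.
apply: negligibleS => x; apply: contra_notP => nH.
(* Nearest lattice point: [floor] gives a half-open cell, and avoiding [H] makes its left inequality
   strict. *)
pose j := \row_k Num.floor (x 0 k / dx + 2^-1).
exists j => k; rewrite /j mxE.
set y := x 0 k / dx.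
have := floor_itv (y + 2^-1) => /andP[h1 h2].
have xE : x 0 k = y * dx by rewrite divfK// gt_eqF.
rewrite xE !ltr_pM2r//; apply/andP; split.
  rewrite lt_neqAle; apply/andP; split; last lra.
  apply/eqP => yE; apply: nH; exists (k, Num.floor (y + 2^-1)) => //=.
  by rewrite /H/= yE -xE.
by move: h2; rewrite intrD; lra.
Qed.

Lemma ae_spacetime_cell (dt : R) : 0 < dt ->
  \forall p \ae @spacetime_measure R d, exists n j,
    n%:R * dt <= p.1 < n.+1%:R * dt /\ cell dx j p.2.
Proof.
move=> dt0; have [A [mA A0 HA]] := ae_cell.
have mS := @measurable_spacetime R d.
(* Two null sets: the negative times, outside the restricted measure, and all times over the null
   set [A] of uncovered positions. *)
exists (~` @spacetime R d `|` setT `*` A); split.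
- apply: measurableU; first exact: measurableC.
  exact: measurableX.
- rewrite /spacetime_measure /= /mrestr setIUl setICl set0U.
  have mTA : measurable ([set: measurableTypeR R] `*` A) by exact: measurableX.
  apply: (subset_measure0 (measurableI _ _ mTA mS) mTA (@subIsetl _ _ _)).
  by rewrite [LHS]product_measure1E// A0 mule0.
- case=> t x /= nE; have [t0|t0] := leP 0 t; last first.
    by left => -[/=]; rewrite in_itv/= andbT leNgt t0.
  right; split => //; apply: HA => -[j jx]; apply: nE.
  exists (Num.truncn (t / dt)), j; split => //.
  by rewrite -ler_pdivlMr// -ltr_pdivrMr// truncn_itv// divr_ge0// ltW.
Qed.

(** [h] serves both reconstructions, as the identity for the moments and as [l1norm] for the
    populations. Almost every point lies in a time slab times an open cell, where [g] is
    prescribed. *)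
Lemma reconstruction_Lnormy_le (V : Type) (h : V -> R) (dt : R)
    (v : nat -> 'rV[int]_d -> V) (g : R * 'rV[R]_d -> V) (M : R) :
  0 < dt -> 0 <= M -> (forall n j, `|h (v n j)| <= M) ->
  is_reconstruction dt dx v g ->
  ('N[@spacetime_measure R d]_+oo[EFin \o (fun p => h (g p))] <= M%:E)%E.
Proof.
move=> dt0 M0 vM gv; apply: Lnormy_le; first by rewrite lee_fin.
have filt_ae := ae_filter_ringOfSetsType (@spacetime_measure R d).
apply: filterS (ae_spacetime_cell dt0) => -[t x] [n [j [tn xj]]].
by rewrite /= lee_fin (gv n j).
Qed.

End cells.

(** * Induction over the time steps and the norm bounds *)

Theorem proposition4p2 (R : realType) (d W : nat)
    (lam : R) (e : vindex W -> 'rV[int]_d) (phi : 'I_d -> R -> R)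
    (u0 : 'rV[R]_d -> R) (L : vindex W -> R) (N : vindex W -> 'I_d -> R)
    (dx omega_s omega_a : R) :
  let c := velocity lam e in
  let uinf : R := fine ('N[lebesgue_rV d]_(+oo%E)[EFin \o u0])%E in
  let feq := equilibrium L N phi in
  let dt := dx / lam in
  let f := populations e omega_s omega_a feq u0 dx in
  let u := fun n j => moment (f n j) in
  (1 <= d)%N -> (1 <= W)%N -> 0 < lam ->
  c vzero = 0 ->
  (forall l, c (vplus l) = - c (vminus l)) ->
  (forall k, (forall v, derivable (phi k) v 1) /\ continuous (derive1 (phi k))) ->
  (forall k, ~ exists a, forall v, phi k v = a) ->
  (forall k, phi k 0 = 0) ->
  u0 \in Lfun (lebesgue_rV d) 1%E ->
  u0 \in Lfun (lebesgue_rV d) +oo%E ->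
  BV u0 ->
  (forall l, L (vplus l) = L (vminus l)) ->
  (forall l k, N (vplus l) k = - N (vminus l) k /\ 0 <= N (vplus l) k) ->
  L vzero + 2 * (\sum_(l < W) L (vplus l)) = 1 ->
  (forall k, N vzero k = 0) ->
  (forall k p,
     2 * (\sum_(l < W) c (vplus l) 0 k * N (vplus l) p) = (k == p)%:R) ->
  0 < dx ->
  0 < omega_s <= 2 -> 0 < omega_a <= 2 ->
  Num.max 0 (omega_s - 1) <= omega_s * L vzero ->
  (forall l,
     omega_a * sup [set `|\sum_(k < d) N (vplus l) k * derive1 (phi k) v|
                   | v in `[- uinf, uinf]] <=
     omega_s * L (vplus l) +
       2^-1 * Num.min (2 - omega_s - omega_a) (Num.min 0 (omega_a - omega_s))) ->
  (forall n j, invariant_box feq uinf (f n j) /\ - uinf <= u n j <= uinf) /\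
  (forall uD : R * 'rV[R]_d -> R, is_reconstruction dt dx u uD ->
     'N[spacetime_measure]_(+oo%E)[EFin \o uD] <= uinf%:E)%E /\
  (forall fD : R * 'rV[R]_d -> (vindex W -> R), is_reconstruction dt dx f fD ->
     'N[spacetime_measure]_(+oo%E)[EFin \o (fun p => l1norm (fD p))] <=
     (\sum_i Num.max `|feq i (- uinf)| `|feq i uinf|)%:E)%E.
Proof.
move=> c uinf feq dt f u _ _ lam0 _ _ phi_C1 _ _ u0_L1 u0_Loo _ L_sym N_odd
  L_sum1 N_vzero _ dx0 /andP[ws0 _] /andP[wa0 _] cond_vzero cond_vplus.
have {}N_odd l k : N (vplus l) k = - N (vminus l) k by exact: (N_odd l k).1.
have uinf0 : 0 <= uinf by rewrite /uinf fine_ge0// Lnorm_ge0.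
have u0_le : \forall x \ae lebesgue_rV d, `|u0 x| <= uinf.
  (* Membership of [u0] in the space of essentially bounded functions makes the norm finite, so
     [fine] does not fall back to 0. *)
  have uinfE : ('N[lebesgue_rV d]_+oo[EFin \o u0] = uinf%:E)%E.
    rewrite fineK// ge0_fin_numE; last exact: Lnorm_ge0.
    by move: u0_Loo; rewrite inE => /andP[_]; rewrite inE.
  have := ae_le_Lnormy (lebesgue_rV d) (EFin \o u0).
  by apply: filterS => x; rewrite uinfE/= lee_fin.
have S_lip l := flux_lipschitz (N (vplus l)) phi_C1 (U := uinf).
have M_ge0 l := flux_deriv_sup_ge0 (N (vplus l)) phi_C1 uinf0.
have Kf n j : invariant_box feq uinf (f n j).
  elim: n j => [|n IHn] j.
    apply: (invariant_box_equilibrium L_sym N_odd L_sum1 N_vzero M_ge0 S_lip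
      ws0 wa0 cond_vzero cond_vplus).
    exact: cell_average_le.
  (* Component [i] is relaxed at its own node [j - e i]; as the box is a product, each component can
     be bounded from a different node. *)
  move=> i; exact: (invariant_box_relaxation L_sym N_odd L_sum1 N_vzero S_lip
    wa0 cond_vzero cond_vplus uinf0 (IHn (j - e i))).
have Ku n j : - uinf <= u n j <= uinf.
  exact: (invariant_box_moment L_sym N_odd L_sum1 N_vzero (Kf n j)).
have dt0 : 0 < dt by exact: divr_gt0.
split=> //; split=> [uD uDE|fD fDE].
  apply: (reconstruction_Lnormy_le (h := idfun) dx0 dt0 uinf0 _ uDE) => n j.
  by rewrite ler_norml; exact: Ku.
apply: (reconstruction_Lnormy_le dx0 dt0 _ _ fDE) => [|n j].
  by apply: sumr_ge0 => i _; rewrite le_max normr_ge0.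
rewrite ger0_norm ?sumr_ge0//; apply: ler_sum => i _.
have /andP[f1 f2] := Kf n j i.
rewrite le_max; apply/orP.
(* A nonnegative value is controlled by the upper corner, a negative one by the lower corner. *)
have [f0|f0] := leP 0 (f n j i); [right|left].
  by rewrite !ger0_norm// (le_trans f0).
by rewrite !ltr0_norm ?lerN2// (le_lt_trans f1).
Qed.
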